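(* Let $p_{-1},p_0,p_1,p_2>0$ be real numbers with $p_{-1}+p_0+p_1+p_2=1$, let $k\ge 1$ be an integer, and let $(X_k(t))_{t\ge 0}$ be the random walk on $\mathbb{Z}$ with $X_k(0)=k$ whose increments $X_k(t+1)-X_k(t)$, $t\ge 0$, are independent and take the values $-1,0,1,2$ with probabilities $p_{-1},p_0,p_1,p_2$ respectively. Let $\tau_k=\min\{t\ge 0 : X_k(t)=0\}$ and let $F(u)=p_{-1}+p_0u+p_1u^2+p_2u^3$. Then for every integer $i\ge 1$, $$\mathbb{P}(\tau_k=i)=\frac{k}{i}\,[u^{i-k}]\,F(u)^i .$$
   Context: For a polynomial $G(u)$ and an integer $m$, $[u^m]G(u)$ denotes the coefficient of $u^m$ in $G(u)$, which is $0$ when $m<0$. By convention $\tau_k=\infty$ if the walk never reaches $0$. *)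

(* Defs.v *)
From HB Require Import structures.
From mathcomp Require Import all_boot all_order all_algebra finmap.
From mathcomp Require Import all_classical all_reals all_analysis.

Set Implicit Arguments.
Unset Strict Implicit.
Unset Printing Implicit Defensive.

Import Order.TTheory GRing.Theory Num.Theory.

Local Open Scope classical_set_scope.
Local Open Scope ring_scope.

(* The library has the discrete sigma-algebra on nat but not on int. *)
HB.instance Definition _ := isPointed.Build int 0.
HB.instance Definition _ := @isMeasurable.Build default_measure_display
  int (@discrete_measurable int) (@discrete_measurable0 int)
  (@discrete_measurableC int) (@discrete_measurableU int).

(* Mutual independence: the product rule over every finite subfamily. *)
Definition independent_family d d' (T : measurableType d)
    (T' : measurableType d') (R : realType) (P : probability T R)
    (I : choiceType) (Y : I -> T -> T') : Prop :=
  forall (J : {fset I}) (B : I -> set T'),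
    (forall j, j \in J -> measurable (B j)) ->
    (P (\bigcap_(j in [set` J]) (Y j @^-1` B j)) =
       \prod_(j <- J) P (Y j @^-1` B j))%E.

Definition increment (T : Type) (X : nat -> T -> int) (t : nat) (w : T) : int :=
  X t.+1 w - X t w.

Record random_walk d (T : measurableType d) (R : realType)
    (P : probability T R) (pm1 p0 p1 p2 : R) (k : nat)
    (X : nat -> {RV P >-> int}) : Prop := RandomWalk {
  walk_start : forall w, X 0%N w = k%:Z ;
  walk_independent : independent_family P (increment X) ;
  walk_stepN1 : forall t, P [set w | increment X t w = -1] = pm1%:E ;
  walk_step0 : forall t, P [set w | increment X t w = 0] = p0%:E ;
  walk_step1 : forall t, P [set w | increment X t w = 1] = p1%:E ;
  walk_step2 : forall t, P [set w | increment X t w = 2] = p2%:E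
}.

(* min {t | X t w = 0}; None stands for infinity. *)
Definition tau (T : Type) (X : nat -> T -> int) (w : T) : option nat :=
  match pselect (exists t, X t w == 0) with
  | left h => Some (ex_minn h)
  | right _ => None
  end.

(* Coefficient extraction at an integer index, 0 at negative indices. *)
Definition coefz (R : nzSemiRingType) (G : {poly R}) (m : int) : R :=
  match m with
  | Posz n => G`_n
  | Negz _ => 0
  end.

Definition step_poly (R : nzSemiRingType) (pm1 p0 p1 p2 : R) : {poly R} :=
  pm1%:P + p0 *: 'X + p1 *: 'X^2 + p2 *: 'X^3.

(* Main.v *)
Require Import Defs.
From HB Require Import structures.
From mathcomp Require Import all_boot all_order all_algebra finmap.
From mathcomp Require Import all_classical all_reals all_analysis.
From mathcomp Require Import ring.

Import Order.TTheory GRing.Theory Num.Theory.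

Local Open Scope classical_set_scope.
Local Open Scope ring_scope.

(** The numbers [k / i * [u^(i-k)] F^i] satisfy the first-step recursion of the
    hitting probabilities: as [sum_n p_n (k+n) u^(k+n) = u (F u^k)'], the
    recursion reduces to comparing the coefficients of [u^i] in
    [u (F^(i+1) u^k)'], computed directly and by the product rule. On the
    probabilistic side, the recursion is proved for the walk restarted at any
    time [s], jointly with an arbitrary prescription of the first [s]
    increments, which turns mutual independence into the Markov property. *)

(** * Polynomial side: the closed form and its first-step recursion *)

Lemma coefz_subz (R : nzSemiRingType) (Q : {poly R}) (m n : nat) :
  coefz Q (m%:Z - n%:Z) = (Q * 'X^n)`_m.
Proof.
rewrite coefMXn; case: ltnP => [mn|nm]; last by rewrite subzn.
by rewrite -opprB subzn 1?ltnW// -(subnSK mn) -NegzE.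
Qed.

Lemma mulX_derivXn (R : comNzRingType) n : 'X * ('X^n)^`() = n%:R * 'X^n :> {poly R}.
Proof.
rewrite derivXn mulrnAr mulr_natl; case: n => [|n] //=.
by rewrite -exprS.
Qed.

Section closed_form.
Variables (R : realFieldType) (pm1 p0 p1 p2 : R).
Local Notation F := (@step_poly R pm1 p0 p1 p2).

(* The claimed law of the hitting time, extended to time 0. *)
Definition hit_prob (i k : nat) : R :=
  if i is 0 then (k == 0%N)%:R
  else k%:R / i%:R * coefz (F ^+ i) (i%:Z - k%:Z).

Lemma mulX_deriv_step_polyXn k :
  'X * (F * 'X^k)^`() =
    (k%:R * pm1)%:P * 'X^k + (k.+1%:R * p0)%:P * 'X^(k.+1)
    + (k.+2%:R * p1)%:P * 'X^(k.+2) + (k.+3%:R * p2)%:P * 'X^(k.+3).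
Proof.
rewrite /step_poly ![in LHS]mulrDl -!scalerAl -!exprS -!exprD add2n add3n.
rewrite -mul_polyC !derivD !(mulrDr 'X).
have derivcX c n : 'X * (c%:P * 'X^n)^`() = (n%:R * c)%:P * 'X^n :> {poly R}.
  rewrite mul_polyC derivZ -scalerAr mulX_derivXn -mul_polyC.
  by rewrite polyCM polyC_natr mulrCA mulrA.
by rewrite -!mul_polyC !derivcX.
Qed.

(** Write [A] for [F^i * X * F' * X^k] and [B] for [F^(i+1) * X^k]. The operator [X * d/dX]
    multiplies the coefficient at [i] by [i], so [i B_i = (i+1) A_i + k B_i]. The right side is
    [(i+1) (A_i + k B_i)], and eliminating [A_i] leaves [i (k+1) B_i]. *)
Lemma coef_step_poly_recursion i k :
  (i * k.+1)%:R * (F ^+ i.+1 * 'X^k)`_i =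
  i.+1%:R * (F ^+ i * ('X * (F * 'X^k)^`()))`_i.
Proof.
set A := F ^+ i * 'X * F^`() * 'X^k; set B := F ^+ i.+1 * 'X^k.
have -> : F ^+ i * ('X * (F * 'X^k)^`()) = A + k%:R *: B.
  rewrite /A /B derivM !mulrDr (mulrCA 'X F) mulX_derivXn.
  by rewrite -mul_polyC polyC_natr exprS; ring.
have Bcoef : i%:R * B`_i = ('X * B^`())`_i.
  rewrite coefXM; case: i @A @B => [|i] A B; first by rewrite mul0r.
  by rewrite coef_deriv mulr_natl.
have Bderiv : 'X * B^`() = i.+1%:R *: A + k%:R *: B.
  rewrite /A /B derivM (mulrDr 'X) (mulrCA 'X (F ^+ _)) mulX_derivXn.
  rewrite deriv_exp /= -!mul_polyC !polyC_natr -mulr_natl exprS.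
  by ring.
rewrite Bderiv !coefD !coefZ in Bcoef.
rewrite coefD coefZ mulrDr -[X in _ = X + _](addrK (k%:R * B`_i)) -Bcoef.
by rewrite natrM -[i.+1%:R]natr1 -[k.+1%:R]natr1; ring.
Qed.

Lemma hit_probS i k :
  hit_prob i.+1 k.+1 = pm1 * hit_prob i k + p0 * hit_prob i k.+1
    + p1 * hit_prob i k.+2 + p2 * hit_prob i k.+3.
Proof.
(* For [i = 0] the right side uses the separate value at time 0: both sides equal [pm1] if [k = 0]
   and vanish otherwise. *)
case: i => [|i].
  rewrite /hit_prob expr1 coefz_subz exprSr mulrA coefMX/= !mulr0 !addr0 coefMXn.
  case: k => [|k] //=; last by rewrite !mulr0.
  by rewrite /step_poly !coefE/= !mulr0 !addr0 divr1 mul1r mulr1.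
have := coef_step_poly_recursion i.+1 k; rewrite mulX_deriv_step_polyXn.
rewrite !mulrDr !coefD ![F ^+ i.+1 * (_%:P * _)]mulrCA !coefCM => h.
rewrite /hit_prob !coefz_subz.
have -> : (F ^+ i.+2 * 'X^(k.+1))`_i.+2 = (F ^+ i.+2 * 'X^k)`_i.+1.
  by rewrite (exprSr 'X) mulrA coefMX.
have i1 : i.+1%:R != 0 :> R by rewrite pnatr_eq0.
have i2 : i.+2%:R != 0 :> R by rewrite pnatr_eq0.
(* Clearing the denominators [i+1] and [i+2] of the two sides gives exactly the coefficient identity
   [h]. *)
apply: (mulfI i1); apply: (mulfI i2).
transitivity ((i.+1 * k.+1)%:R * (F ^+ i.+2 * 'X^k)`_i.+1).
  by rewrite natrM; field; rewrite -natrD.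
by rewrite h; field; rewrite nat1r.
Qed.

Lemma hit_probS0 i : hit_prob i.+1 0 = 0.
Proof. by rewrite /hit_prob !mul0r. Qed.
End closed_form.

(** * Hitting events and cylinders of increments *)

Section first_hit.
Variables (T : Type) (X : nat -> T -> int).

(** The position [x] at time [s] is a free parameter, not [X s w], so the event depends only on the
    increments from time [s] on. *)
Fixpoint first_hit (s i : nat) (x : int) : set T :=
  if i is i'.+1 then
    [set w | x <> 0 /\ first_hit s.+1 i' (x + increment X s w) w]
  else [set w | x = 0].

Lemma first_hitE s i w : first_hit s i (X s w) w <->
  X (s + i)%N w = 0 /\ forall j, (j < i)%N -> X (s + j)%N w <> 0.
Proof.
elim: i s => [|i IHi] s /=; first by rewrite addn0; split=> [|[]].
rewrite /increment subrKC IHi addSnnS; split=> [[Xs0 [Xi0 Xlt]]|[Xi0 Xlt]].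
  by split=> // -[|j] ji; [rewrite addn0|rewrite -addSnnS; apply: Xlt].
split; first by rewrite -[s in X s](addn0 s); apply: Xlt.
by split=> // j ji; rewrite addSnnS; apply: Xlt.
Qed.

Lemma tau_SomeE i w : tau X w = Some i <-> first_hit 0 i (X 0%N w) w.
Proof.
rewrite first_hitE /tau; case: pselect => [h|noh]; last first.
  split=> // -[Xi0 _]; case: noh; exists i; exact/eqP.
case: ex_minnP => m /eqP Xm0 m_min; split=> [[<-]|[Xi0 Xlt]].
  split=> // j jm /eqP /m_min; by rewrite leqNgt jm.
congr Some; apply/eqP; rewrite eqn_leq m_min ?Xi0 //= leqNgt.
by apply/negP => /Xlt; rewrite add0n Xm0.
Qed.

Definition cylinder (s : nat) (c : nat -> int) : set T :=
  \bigcap_(r in `I_s) [set w | increment X r w = c r].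

(** Prescribes the increment at time [s] as well; values of [c] beyond [s] do not affect the
    cylinder of length [s+1]. *)
Definition extend (s : nat) (c : nat -> int) (y : int) (r : nat) : int :=
  if r == s then y else c r.

Lemma cylinder_extend s c y :
  cylinder s.+1 (extend s c y) =
  cylinder s c `&` [set w | increment X s w = y].
Proof.
apply/seteqP; split=> w /=.
  move=> h; split=> [r /= rs|].
    by have := h r (ltnW rs); rewrite /extend ltn_eqF.
  by have := h s (ltnSn s); rewrite /extend eqxx.
move=> [h hs] r /=; rewrite ltnS leq_eqVlt /extend => /predU1P[->|rs].
  by rewrite eqxx.
by rewrite ltn_eqF//; apply: h.
Qed.

End first_hit.

Arguments first_hit {T}.
Arguments cylinder {T}.

(** * Probabilistic side: measurability, independence and the Markov property *)

Section random_walk.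
Context d (T : measurableType d) (R : realType) (P : probability T R).
Variables (pm1 p0 p1 p2 : R) (k : nat) (X : nat -> {RV P >-> int}).
Hypothesis hsum : pm1 + p0 + p1 + p2 = 1.
Hypothesis hX : random_walk pm1 p0 p1 p2 k X.
Local Notation hit_prob := (@hit_prob R pm1 p0 p1 p2).

Lemma measurable_increment t (B : set int) :
  measurable ([set w | B (increment X t w)] : set T).
Proof.
(* Only countably many pairs of consecutive positions exist, so the event is a countable union of
   measurable pieces. *)
have -> : [set w | B (increment X t w)] =
    \bigcup_(b : int * int) [set w | B (b.1 - b.2) /\
      (X t.+1 @^-1` [set b.1] `&` X t @^-1` [set b.2]) w].
  apply/seteqP; split=> w /=.
    by exists (X t.+1 w, X t w).
  by move=> [[b c]] _ /= [Bbc [Xb Xc]]; rewrite /increment Xb Xc.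
apply: countable_bigcupT_measurable => // -[b c] /=.
have [Bbc|nBbc] := pselect (B (b - c)).
  rewrite (_ : [set w | _] = X t.+1 @^-1` [set b] `&` X t @^-1` [set c]).
    by apply: measurableI; apply: measurable_funPTI.
  by apply/seteqP; split=> [w []|w].
rewrite (_ : [set w | _] = set0) //.
by apply/seteqP; split=> [w []|w].
Qed.

Lemma measurable_first_hit s i x : measurable (first_hit X s i x).
Proof.
elim: i s x => [|i IHi] s x /=.
  have [->|x0] := eqVneq x 0; first by rewrite (_ : [set w | _] = setT) //; apply/seteqP.
  rewrite (_ : [set w | _] = set0) //; apply/seteqP; split=> // w /= /eqP.
  by rewrite (negbTE x0).
have [->|/eqP x0] := eqVneq x 0.
  by rewrite (_ : [set w | _] = set0) //; apply/seteqP; split=> // w [].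
rewrite (_ : [set w | _] = \bigcup_(y : int)
    ([set w | increment X s w = y] `&` first_hit X s.+1 i (x + y))).
  apply: countable_bigcupT_measurable => // y.
  by apply: measurableI; [exact: (measurable_increment _ [set y])|exact: IHi].
apply/seteqP; split=> w /=; first by move=> [_ h]; exists (increment X s w).
by move=> [y _ [<-]].
Qed.

Lemma measurable_cylinder s c : measurable (cylinder X s c).
Proof.
apply: bigcap_measurableType => r _.
exact: (measurable_increment r [set c r]).
Qed.

Lemma mem_fset_iota (s r : nat) : (r \in [fset t in iota 0 s]%fset) = (r < s)%N.
Proof. by rewrite !inE /= mem_iota. Qed.

Lemma cylinder_fset s c :
  cylinder X s c = \bigcap_(r in [set` [fset r in iota 0 s]%fset])
    (increment X r @^-1` [set c r]).
Proof.
by apply: eq_bigcapl; split=> r /=; rewrite mem_fset_iota.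
Qed.

(** The product rule is applied to the times up to [s] and to those before [s]; the two products
    differ by the factor at [s]. *)
Lemma probability_cylinderS s c : P (cylinder X s.+1 c) =
  (P [set w | increment X s w = c s] * P (cylinder X s c))%E.
Proof.
have ext : cylinder X s.+1 c =
    \bigcap_(r in [set` (s |` [fset r in iota 0 s])%fset])
    (increment X r @^-1` [set c r]).
  by apply: eq_bigcapl; split=> r /=;
    rewrite in_fset1U mem_fset_iota ltnS [(r <= s)%N]leq_eqVlt.
rewrite ext cylinder_fset !(walk_independent hX)// big_fsetU1//.
by rewrite mem_fset_iota ltnn.
Qed.

Local Notation step s y := [set w | increment X s w = y%R].

Lemma measure_step_split s (A : set T) : measurable A ->
  P A = (P (A `&` step s (-1))
    + P (A `&` step s 0)
    + P (A `&` step s 1)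
    + P (A `&` step s 2))%E.
Proof.
(* [N] collects all other increments. Splitting the whole space gives [1 = 1 + P N] by [hsum], so
   [N] is null. *)
pose N := [set w | ~ [\/ increment X s w = -1, increment X s w = 0,
  increment X s w = 1 | increment X s w = 2]].
have split A' : measurable A' -> P A' =
  (P (A' `&` step s (-1))
    + P (A' `&` step s 0)
    + P (A' `&` step s 1)
    + P (A' `&` step s 2)
    + P (A' `&` N))%E.
  move=> mA.
  have mE y : measurable (step s y).
    exact: (measurable_increment s [set y]).
  rewrite (measureDI P mA (mE (-1))) addeC -!addeA; congr (_ + _)%E.
  rewrite (measureDI P (measurableD mA (mE (-1))) (mE 0)) addeC; congr (_ + _)%E; last first.
    by congr (P _); apply/seteqP; split=> w /=; [move=> [[]]|move=> [Aw ->]].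
  rewrite (measureDI P (measurableD (measurableD mA (mE (-1))) (mE 0)) (mE 1)).
  rewrite addeC; congr (_ + _)%E; last first.
    by congr (P _); apply/seteqP; split=> w /=; [move=> [[[]]]|move=> [Aw ->]].
  rewrite (measureDI P (measurableD (measurableD (measurableD mA (mE (-1)))
    (mE 0)) (mE 1)) (mE 2)) addeC; congr (_ + _)%E; last first.
    by congr (P _); apply/seteqP; split=> w /=; [move=> [[[[]]]]|move=> [Aw ->]].
  congr (P _); apply/seteqP; split=> w /=; first by move=> [[[[Aw ?] ?] ?] ?]; split=> // -[].
  by move=> [Aw h]; do !split=> //; move=> e; apply: h; rewrite e;
    [constructor 1|constructor 2|constructor 3|constructor 4].
have mN : measurable N.
  exact: (measurable_increment s [set y | ~ [\/ y = -1, y = 0, y = 1 | y = 2]]).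
have PN : P N = 0.
  have := split setT measurableT.
  rewrite !setTI probability_setT.
  rewrite (walk_stepN1 hX) (walk_step0 hX) (walk_step1 hX) (walk_step2 hX).
  have /fineK <- : P N \is a fin_num by exact: fin_num_measure.
  rewrite -!EFinD => -[]; by rewrite hsum -[LHS]addr0 => /addrI <-.
move=> mA; rewrite [LHS]split//.
suff -> : P (A `&` N) = 0 by rewrite adde0.
apply/eqP; rewrite eq_le measure_ge0 andbT -PN.
exact: measureIr.
Qed.

(** Induction on [i] with the past arbitrary: one step lengthens the cylinder by one increment and
    multiplies its probability [r] by that of the step. Natural starting points suffice, since from
    [m+1] the walk moves down by at most one. *)
Lemma probability_cylinder_first_hit i s c r m : P (cylinder X s c) = r%:E ->
  P (cylinder X s c `&` first_hit X s i m%:Z) = (r * hit_prob i m)%:E.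
Proof.
elim: i s c r m => [|i IHi] s c r m Pc.
  case: m => [|m] /=.
    rewrite (_ : [set _ | _] = setT) ?setIT ?mulr1//.
    by apply/seteqP; split.
  rewrite (_ : [set _ | _] = set0) ?setI0 ?measure0 ?mulr0//.
  by apply/seteqP; split.
(* From 0 the hit has already occurred at once, so a first hit after a positive delay is
   impossible. *)
case: m => [|m].
  rewrite hit_probS0 mulr0 (_ : first_hit _ _ _ _ = set0) ?setI0 ?measure0//.
  by apply/seteqP; split=> // w [].
rewrite hit_probS (measure_step_split s); last first.
  by apply: measurableI; [exact: measurable_cylinder|exact: measurable_first_hit].
have first_step y p (n : nat) : P [set w | increment X s w = y] = p%:E ->
    m.+1%:Z + y = n%:Z ->
    P (cylinder X s c `&` first_hit X s i.+1 m.+1 `&`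
       [set w | increment X s w = y]) = (p * r * hit_prob i n)%:E.
  (* The observed step [y] joins the prescribed past, and the walk restarts from [n] at time
     [s+1]. *)
  move=> Py yn; rewrite -(IHi s.+1 (extend s c y)).
    congr (P _); rewrite cylinder_extend; apply/seteqP; split=> w /=.
      by move=> [[cw [_ hw]] yw]; rewrite yw yn in hw.
    by move=> [[cw yw] hw]; rewrite yw yn.
  rewrite probability_cylinderS {1}/extend eqxx Py.
  suff -> : cylinder X s (extend s c y) = cylinder X s c by rewrite Pc.
  by apply: eq_bigcapr => t /= ts; rewrite /extend ltn_eqF.
rewrite (first_step _ _ m (walk_stepN1 hX s)); last by rewrite intS addrC addKr.
rewrite (first_step _ _ m.+1 (walk_step0 hX s)) ?addr0//.
rewrite (first_step _ _ m.+2 (walk_step1 hX s)); last by rewrite addrC -intS.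
rewrite (first_step _ _ m.+3 (walk_step2 hX s)); last by rewrite -PoszD addn2.
by rewrite -!EFinD; congr EFin; ring.
Qed.

End random_walk.

Theorem mainTheorem1 (R : realType) (pm1 p0 p1 p2 : R)
  (hpm1 : 0 < pm1) (hp0 : 0 < p0) (hp1 : 0 < p1) (hp2 : 0 < p2)
  (hsum : pm1 + p0 + p1 + p2 = 1)
  (k : nat) (hk : (1 <= k)%N)
  (d : measure_display) (T : measurableType d) (P : probability T R)
  (X : nat -> {RV P >-> int}) (hX : random_walk pm1 p0 p1 p2 k X) :
  forall i : nat, (1 <= i)%N ->
    P [set w | tau X w = Some i] =
      (k%:R / i%:R * coefz (step_poly pm1 p0 p1 p2 ^+ i) (i%:Z - k%:Z))%:E.
Proof.
move=> [//|i] _.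
(* With no increment prescribed, the cylinder is the whole space, so [r = 1]. *)
have cyl0 : cylinder (X : nat -> T -> int) 0 (fun=> 0) = setT by apply/seteqP; split=> // w _ r.
have := @probability_cylinder_first_hit _ _ _ _ _ _ _ _ _ _ hsum hX i.+1 0 (fun=> 0) 1 k.
rewrite cyl0 probability_setT setTI mul1r => <- //.
congr (P _); apply/seteqP; split=> w /=.
  by move/tau_SomeE; rewrite (walk_start hX).
by move=> h; apply/tau_SomeE; rewrite (walk_start hX).
Qed.
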